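(* Let $\mathcal{X}=\prod_{i\in\mathcal{N}}\mathbb{R}^n$ and $\mathcal{Y}=\prod_{i\in\mathcal{N}}\mathbb{R}^{m_i}\times\mathbb{R}^{m_0}$, with elements $\mathbf{x}=[x_i]_{i\in\mathcal{N}}$ and $\mathbf{y}=[\boldsymbol{\theta}^\top\ \boldsymbol{\lambda}^\top]^\top$, $\boldsymbol{\theta}=[\theta_i]_{i\in\mathcal{N}}\in\mathbb{R}^m$, $m=\sum_{i\in\mathcal{N}}m_i$, $\boldsymbol{\lambda}\in\mathbb{R}^{m_0}$. Let $\Phi(\mathbf{x})=\sum_{i\in\mathcal{N}}\Phi_i(x_i)$ with $\Phi_i=\rho_i+f_i$ composite convex, and $h(\mathbf{y})=h_0(\boldsymbol{\lambda})+\sum_{i\in\mathcal{N}}h_i(\theta_i)$ with $h_0$ and $\{h_i\}_{i\in\mathcal{N}}$ closed convex functions with simple prox maps. Given $A_0\in\mathbb{R}^{m_0\times n|\mathcal{N}|}$ and $A_i\in\mathbb{R}^{m_i\times n}$, $i\in\mathcal{N}$, let $A=\mathrm{diag}([A_i]_{i\in\mathcal{N}})\in\mathbb{R}^{m\times n|\mathcal{N}|}$ (block diagonal), $T=[A^\top\ A_0^\top]^\top$, and $\mathcal{L}(\mathbf{x},\mathbf{y})=\Phi(\mathbf{x})+\langle T\mathbf{x},\mathbf{y}\rangle-h(\mathbf{y})$. Let $\gamma>0$, $\tau_i,\kappa_i>0$ ($i\in\mathcal{N}$). Given the initial point $(\mathbf{x}^0,\mathbf{y}^0)$, let $\{\mathbf{x}^k,\mathbf{y}^k\}_{k\ge1}$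 be generated for $k\ge0$ by $$\mathbf{x}^{k+1}=\arg\min_{\mathbf{x}}\ \rho(\mathbf{x})+f(\mathbf{x}^k)+\langle\nabla f(\mathbf{x}^k),\mathbf{x}-\mathbf{x}^k\rangle+\langle T\mathbf{x},\mathbf{y}^k\rangle+D_x(\mathbf{x},\mathbf{x}^k),$$ $$\mathbf{y}^{k+1}=\arg\min_{\mathbf{y}}\ h(\mathbf{y})-\langle T(2\mathbf{x}^{k+1}-\mathbf{x}^k),\mathbf{y}\rangle+D_y(\mathbf{y},\mathbf{y}^k),$$ where $\rho(\mathbf{x})=\sum_i\rho_i(x_i)$, $f(\mathbf{x})=\sum_if_i(x_i)$. If $$\bar{\mathbf{Q}}(A,A_0)=\begin{bmatrix}\bar{\mathbf{D}}_\tau&-A^\top&-A_0^\top\\-A&\mathbf{D}_\kappa&0\\-A_0&0&\mathbf{D}_\gamma\end{bmatrix}\succeq0,$$ where $\bar{\mathbf{D}}_\tau=\mathrm{diag}\big([(\frac1{\tau_i}-L_i)I_n]_{i\in\mathcal{N}}\big)$, $\mathbf{D}_\kappa=\mathrm{diag}([\frac1{\kappa_i}I_{m_i}]_{i\in\mathcal{N}})$, $\mathbf{D}_\gamma=\frac1\gamma I_{m_0}$, then for all $K\ge1$ and all $(\mathbf{x},\mathbf{y})\in\mathcal{X}\times\mathcal{Y}$, $$\mathcal{L}(\bar{\mathbf{x}}^K,\mathbf{y})-\mathcal{L}(\mathbf{x},\bar{\mathbf{y}}^K)\le\frac1K\Big(D_x(\mathbf{x},\mathbf{x}^0)+D_y(\mathbf{y},\mathbf{y}^0)-\langle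 T(\mathbf{x}-\mathbf{x}^0),\mathbf{y}-\mathbf{y}^0\rangle\Big),$$ where $\bar{\mathbf{x}}^K=\frac1K\sum_{k=1}^K\mathbf{x}^k$ and $\bar{\mathbf{y}}^K=\frac1K\sum_{k=1}^K\mathbf{y}^k$.
   Context: $\mathcal{N}=\{1,\dots,N\}$. For each $i\in\mathcal{N}$, $\rho_i:\mathbb{R}^n\to\mathbb{R}\cup\{+\infty\}$ is a possibly non-smooth convex function whose prox map $x\mapsto\arg\min_y\{\rho_i(y)+\frac12\|y-x\|^2\}$ is efficiently computable, and $f_i:\mathbb{R}^n\to\mathbb{R}$ is a smooth convex function, differentiable on an open set containing $\mathrm{dom}\,\rho_i$ with Lipschitz continuous gradient with constant $L_i$. $\|\cdot\|$ is the Euclidean norm and $\|z\|_Q=(z^\top Qz)^{1/2}$ for $Q\succ0$. With $\mathbf{D}_\tau=\mathrm{diag}([\frac1{\tau_i}I_n]_{i\in\mathcal{N}})$, the Bregman distances are $D_x(\mathbf{x},\bar{\mathbf{x}})=\frac12\|\mathbf{x}-\bar{\mathbf{x}}\|_{\mathbf{D}_\tau}^2$ and $D_y(\mathbf{y},\bar{\mathbf{y}})=\frac12\|\boldsymbol{\theta}-\bar{\boldsymbol{\theta}}\|_{\mathbf{D}_\kappa}^2+\frac12\|\boldsymbol{\lambda}-\bar{\boldsymbol{\lambda}}\|_{\mathbf{D}_\gamma}^2$.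
   Formalization: The initial point is not arbitrary: for each i, the segments from x_i^0 to points of dom ρ_i must lie in the open set where f_i has L_i-Lipschitz gradient (automatic if x^0 ∈ dom ρ or that set is all of R^n); for unrestricted x^0 the claim can fail. *)

(* Defs.v *)
From HB Require Import structures.
From mathcomp Require Import all_boot all_order all_algebra.
From mathcomp Require Import all_classical all_reals all_analysis.
Import Order.TTheory GRing.Theory Num.Theory.
Import numFieldNormedType.Exports.

Set Implicit Arguments.
Unset Strict Implicit.
Unset Printing Implicit Defensive.

Local Open Scope classical_set_scope.
Local Open Scope ring_scope.

Section Euclidean.
Variables (R : realType) (d : nat).
Implicit Types (x y z : 'cV[R]_d) (Q : 'M[R]_d).

Definition inner x y : R := (x^T *m y) 0 0.

(* The norm of the library on matrices is the max norm, hence this one. *)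
Definition enorm x : R := Num.sqrt (inner x x).

Definition qnorm Q z : R := Num.sqrt ((z^T *m Q *m z) 0 0).

Definition psdmx Q : Prop :=
  Q^T = Q /\ forall z, 0 <= (z^T *m Q *m z) 0 0.

Definition grad (f : 'cV[R]_d -> R) x : 'cV[R]_d :=
  \col_j derive (f : 'cV[R]_d -> R^o) x (delta_mx j 0).

Definition elipschitz_on (L : R) (U : set 'cV[R]_d)
    (g : 'cV[R]_d -> 'cV[R]_d) : Prop :=
  forall x y, U x -> U y -> enorm (g x - g y) <= L * enorm (x - y).

End Euclidean.

Section ExtendedValued.
Variables (R : realType) (d : nat).
Implicit Types F : 'cV[R]_d -> \bar R.

Definition edom F : set 'cV[R]_d := [set x | (F x < +oo)%E].

Definition eproper F : Prop :=
  (forall x, (-oo < F x)%E) /\ exists x, edom F x.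

(* Used for functions that never take the value -oo; 0 * +oo = 0 here. *)
Definition econvex F : Prop :=
  forall (x y : 'cV[R]_d) (t : R), 0 <= t <= 1 ->
    (F (t *: x + (1 - t) *: y)%R <= t%:E * F x + (1 - t)%:E * F y)%E.

(* A function that is identically +oo has no minimizer in this sense. *)
Definition is_argmin F x : Prop :=
  F x \is a fin_num /\ forall y, (F x <= F y)%E.

Definition has_prox F : Prop :=
  forall x, exists p,
    is_argmin (fun y => F y + (2^-1 * enorm (y - x) ^+ 2)%:E)%E p.

End ExtendedValued.

(* The product spaces are spaces of stacked columns:
   X = R^(n + ... + n) with N summands, and Y = R^((m_1 + ... + m_N) + m_0),
   where y = [theta; lambda]. *)
Section Problem.
Variables (R : realType) (N n : nat) (m : 'I_N -> nat) (m0 : nat).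

Local Notation spaceX := 'cV[R]_(\sum_(i < N) n).
Local Notation spaceY := 'cV[R]_(\sum_(i < N) m i + m0).

Definition xblock (x : spaceX) (i : 'I_N) : 'cV[R]_n :=
  submxcol (p_ := fun=> n) x i.

Definition thetapart (y : spaceY) : 'cV[R]_(\sum_(i < N) m i) := usubmx y.
Definition lambdapart (y : spaceY) : 'cV[R]_m0 := dsubmx y.

Definition thetablock (y : spaceY) (i : 'I_N) : 'cV[R]_(m i) :=
  submxcol (thetapart y) i.

Definition Dtau (tau : 'I_N -> R) : 'M[R]_(\sum_(i < N) n) :=
  \mxdiag_(i < N) (((tau i)^-1)%:M : 'M[R]_n).

Definition Dtaubar (tau L : 'I_N -> R) : 'M[R]_(\sum_(i < N) n) :=
  \mxdiag_(i < N) (((tau i)^-1 - L i)%:M : 'M[R]_n).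

Definition Dkappa (kappa : 'I_N -> R) : 'M[R]_(\sum_(i < N) m i) :=
  \mxdiag_(i < N) (((kappa i)^-1)%:M : 'M[R]_(m i)).

Definition Dgamma (gamma : R) : 'M[R]_m0 := (gamma^-1)%:M.

(* \mxdiag only accepts square blocks. *)
Definition blockA (A : forall i : 'I_N, 'M[R]_(m i, n)) :
    'M[R]_(\sum_(i < N) m i, \sum_(i < N) n) :=
  \mxblock_(i < N, j < N) (if i == j then A i else 0).

Definition mxT (A : forall i : 'I_N, 'M[R]_(m i, n))
    (A0 : 'M[R]_(m0, \sum_(i < N) n)) :
    'M[R]_(\sum_(i < N) m i + m0, \sum_(i < N) n) :=
  col_mx (blockA A) A0.

Definition Qbar (A : forall i : 'I_N, 'M[R]_(m i, n))
    (A0 : 'M[R]_(m0, \sum_(i < N) n)) (tau L kappa : 'I_N -> R) (gamma : R) :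
    'M[R]_(\sum_(i < N) n + (\sum_(i < N) m i + m0)) :=
  block_mx (Dtaubar tau L)
           (row_mx (- (blockA A)^T) (- A0^T))
           (col_mx (- blockA A) (- A0))
           (block_mx (Dkappa kappa) 0 0 (Dgamma gamma)).

Definition bregmanX (tau : 'I_N -> R) (x x' : spaceX) : R :=
  2^-1 * qnorm (Dtau tau) (x - x') ^+ 2.

Definition bregmanY (kappa : 'I_N -> R) (gamma : R) (y y' : spaceY) : R :=
  2^-1 * qnorm (Dkappa kappa) (thetapart y - thetapart y') ^+ 2
  + 2^-1 * qnorm (Dgamma gamma) (lambdapart y - lambdapart y') ^+ 2.

Definition rho_sum (rho : 'I_N -> 'cV[R]_n -> \bar R) (x : spaceX) : \bar R :=
  (\sum_(i < N) rho i (xblock x i))%E.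

Definition f_sum (f : 'I_N -> 'cV[R]_n -> R) (x : spaceX) : R :=
  \sum_(i < N) f i (xblock x i).

Definition Phi (rho : 'I_N -> 'cV[R]_n -> \bar R) (f : 'I_N -> 'cV[R]_n -> R)
    (x : spaceX) : \bar R :=
  (\sum_(i < N) (rho i (xblock x i) + (f i (xblock x i))%:E))%E.

Definition h_sum (h0 : 'cV[R]_m0 -> \bar R)
    (h : forall i : 'I_N, 'cV[R]_(m i) -> \bar R) (y : spaceY) : \bar R :=
  (h0 (lambdapart y) + \sum_(i < N) h i (thetablock y i))%E.

Definition Lagrangian (rho : 'I_N -> 'cV[R]_n -> \bar R)
    (f : 'I_N -> 'cV[R]_n -> R) (h0 : 'cV[R]_m0 -> \bar R)
    (h : forall i : 'I_N, 'cV[R]_(m i) -> \bar R)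
    (A : forall i : 'I_N, 'M[R]_(m i, n)) (A0 : 'M[R]_(m0, \sum_(i < N) n))
    (x : spaceX) (y : spaceY) : \bar R :=
  (Phi rho f x + (inner (mxT A A0 *m x) y)%:E - h_sum h0 h y)%E.

Definition xobjective (rho : 'I_N -> 'cV[R]_n -> \bar R)
    (f : 'I_N -> 'cV[R]_n -> R)
    (A : forall i : 'I_N, 'M[R]_(m i, n)) (A0 : 'M[R]_(m0, \sum_(i < N) n))
    (tau : 'I_N -> R) (xk : spaceX) (yk : spaceY) (x : spaceX) : \bar R :=
  (rho_sum rho x
   + (f_sum f xk + inner (grad (f_sum f) xk) (x - xk)
      + inner (mxT A A0 *m x) yk + bregmanX tau x xk)%:E)%E.

Definition yobjective (h0 : 'cV[R]_m0 -> \bar R)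
    (h : forall i : 'I_N, 'cV[R]_(m i) -> \bar R)
    (A : forall i : 'I_N, 'M[R]_(m i, n)) (A0 : 'M[R]_(m0, \sum_(i < N) n))
    (kappa : 'I_N -> R) (gamma : R)
    (xk xk1 : spaceX) (yk y : spaceY) : \bar R :=
  (h_sum h0 h y
   + (- inner (mxT A A0 *m (2 *: xk1 - xk)) y + bregmanY kappa gamma y yk)%:E)%E.

End Problem.

Definition ergodic (R : realType) (d : nat) (u : nat -> 'cV[R]_d) (K : nat) :
    'cV[R]_d :=
  K%:R^-1 *: \sum_(1 <= k < K.+1) u k.

(* Main.v *)
Require Import Defs.
From HB Require Import structures.
From mathcomp Require Import all_boot all_order all_algebra.
From mathcomp Require Import all_classical all_reals all_analysis.
From mathcomp Require Import ring lra.
Import Order.TTheory GRing.Theory Num.Theory.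
Import numFieldNormedType.Exports.

(** Ergodic O(1/K) rate of a primal-dual proximal gradient method.

    Fix a comparison pair (x, y) and put
      V_k = D_x(x, x^k) + D_y(y, y^k) - <T (x - x^k), y - y^k>.
    The whole proof is the one-step inequality
      L(x^(k+1), y) - L(x, y^(k+1)) <= V_k - V_(k+1),
    which telescopes to V_0 - V_K <= V_0, followed by the convexity of Phi and
    h, which turns the average of the left-hand sides into the gap at the
    ergodic means ([econvex_ergodic]).

    The one-step inequality combines three facts.
    - Each iterate minimizes a convex function plus a quadratic, so its
      objective value there is below the value at any other point by at least
      the Bregman distance between the two points ([argmin_three_point], used in
      [xstep_ineq] and [ystep_ineq]).
    - The smooth part f is linearized at x^k; passing back from the linear model
      to f costs (1/2) sum_i L_i |x_i^(k+1) - x_i^k|^2, by the descent lemma at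
      x^(k+1) and the gradient inequality at x ([f_sum_step]).
    - The bilinear terms regroup exactly, thanks to the extrapolated point
      2 x^(k+1) - x^k, into V_k - V_(k+1) minus the same expression between two
      consecutive iterates ([merit_three_point]).
    What is left over between consecutive iterates is half the quadratic form of
    Qbar, hence nonnegative ([Qbar_form], [merit_ge]).  The same bound gives
    V_K >= 0, because L_i |x_i - x_i^K|^2 >= 0 follows from the Lipschitz
    inequality between x_i and x_i^K.

    If h(y) = +oo or Phi(x) = +oo the gap is -oo and there is nothing to prove;
    otherwise every quantity above is a real number. *)

Set Implicit Arguments.
Unset Strict Implicit.

Local Open Scope classical_set_scope.
Local Open Scope ring_scope.

(** * The Euclidean inner product *)

Section InnerProduct.
Context {R : realType}.

Lemma innerE d (x y : 'cV[R]_d) : inner x y = \sum_i x i 0 * y i 0.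
Proof. by rewrite /inner mxE; apply: eq_bigr => i _; rewrite mxE. Qed.

Lemma innerC d (x y : 'cV[R]_d) : inner x y = inner y x.
Proof. by rewrite !innerE; apply: eq_bigr => i _; rewrite mulrC. Qed.

Lemma innerDl d (x y z : 'cV[R]_d) : inner (x + y) z = inner x z + inner y z.
Proof. by rewrite /inner linearD mulmxDl mxE. Qed.

Lemma innerDr d (x y z : 'cV[R]_d) : inner z (x + y) = inner z x + inner z y.
Proof. by rewrite /inner mulmxDr mxE. Qed.

Lemma innerZl d (a : R) (x y : 'cV[R]_d) : inner (a *: x) y = a * inner x y.
Proof. by rewrite /inner linearZ -scalemxAl mxE. Qed.

Lemma innerZr d (a : R) (x y : 'cV[R]_d) : inner y (a *: x) = a * inner y x.
Proof. by rewrite /inner -scalemxAr mxE. Qed.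

Lemma innerNl d (x y : 'cV[R]_d) : inner (- x) y = - inner x y.
Proof. by rewrite -scaleN1r innerZl mulN1r. Qed.

Lemma innerNr d (x y : 'cV[R]_d) : inner y (- x) = - inner y x.
Proof. by rewrite -scaleN1r innerZr mulN1r. Qed.

Definition inner_lin :=
  (innerDl, innerDr, innerNl, innerNr, innerZl, innerZr).

Lemma inner0l d (x : 'cV[R]_d) : inner 0 x = 0.
Proof. by rewrite -(scale0r 0) innerZl mul0r. Qed.

Lemma inner_mulmx d1 d2 (M : 'M[R]_(d1, d2)) x y :
  inner (M *m x) y = inner x (M^T *m y).
Proof. by rewrite /inner trmx_mul mulmxA. Qed.

Lemma inner_ge0 d (x : 'cV[R]_d) : 0 <= inner x x.
Proof. by rewrite innerE sumr_ge0// => i _; rewrite -expr2 sqr_ge0. Qed.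

Lemma sqr_enorm d (x : 'cV[R]_d) : enorm x ^+ 2 = inner x x.
Proof. by rewrite sqr_sqrtr// inner_ge0. Qed.

Lemma enorm_ge0 d (x : 'cV[R]_d) : 0 <= enorm x.
Proof. exact: sqrtr_ge0. Qed.

Lemma enormZ d (a : R) (x : 'cV[R]_d) : enorm (a *: x) = `|a| * enorm x.
Proof.
by rewrite /enorm !inner_lin mulrA -expr2 sqrtrM ?sqr_ge0// sqrtr_sqr.
Qed.

Lemma enorm_eq0 d (x : 'cV[R]_d) : enorm x = 0 -> x = 0.
Proof.
move=> x0; have : inner x x = 0 by rewrite -sqr_enorm x0 expr0n.
rewrite innerE => /psumr_eq0P xx; apply/matrixP => i j; rewrite ord1 mxE.
have /eqP := xx (fun k _ => ltac:(by rewrite -expr2 sqr_ge0)) i isT.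
by rewrite mulf_eq0 orbb => /eqP.
Qed.

(** Cauchy-Schwarz: expand the square of |y| x - |x| y. *)
Lemma inner_le_enorm d (x y : 'cV[R]_d) : inner x y <= enorm x * enorm y.
Proof.
have [/enorm_eq0 ->|x0] := eqVneq (enorm x) 0.
  by rewrite inner0l mulr_ge0// enorm_ge0.
have [/enorm_eq0 ->|y0] := eqVneq (enorm y) 0.
  by rewrite innerC inner0l mulr_ge0// enorm_ge0.
have xy0 : 0 < enorm x * enorm y.
  by rewrite mulr_gt0// lt_neqAle eq_sym enorm_ge0 andbT.
have := inner_ge0 (enorm y *: x - enorm x *: y).
rewrite !inner_lin (innerC y x) -!sqr_enorm => h.
by rewrite -(ler_pM2l xy0); nra.
Qed.

Lemma inner_ergodic d1 d2 (M : 'M[R]_(d2, d1)) (u : nat -> 'cV[R]_d1) K y :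
  inner (M *m ergodic u K) y =
  K%:R^-1 * \sum_(1 <= k < K.+1) inner (M *m u k) y.
Proof.
rewrite /ergodic -scalemxAr innerZl; congr (_ * _).
elim/big_rec2: _ => [|k a b _ <-]; first by rewrite mulmx0 inner0l.
by rewrite mulmxDr innerDl.
Qed.

End InnerProduct.

(** * Quadratic forms *)

Section QuadraticForms.
Context {R : realType} {d : nat}.

Lemma lineB (u v w : 'cV[R]_d) (t : R) :
  t *: u + (1 - t) *: v - w = t *: (u - w) + (1 - t) *: (v - w).
Proof. by apply/matrixP => j k; rewrite !mxE; ring. Qed.

Lemma qnormE (Q : 'M[R]_d) z : 0 <= inner z (Q *m z) ->
  qnorm Q z ^+ 2 = inner z (Q *m z).
Proof. by rewrite /inner mulmxA => h; rewrite sqr_sqrtr. Qed.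

(** Exact defect of convexity of a quadratic form: this is what makes the
    three-point inequality below hold with the full Bregman distance. *)
Lemma quad_conv (Q : 'M[R]_d) (t : R) u v :
  let q w := inner w (Q *m w) in
  q (t *: u + (1 - t) *: v) = t * q u + (1 - t) * q v - t * (1 - t) * q (u - v).
Proof.
by rewrite /= !(mulmxDr, mulmxN, inner_lin) -!scalemxAr !inner_lin; ring.
Qed.

End QuadraticForms.

(** * Smooth convex functions *)

Section Smooth.
Context {R : realType} {d : nat}.
Implicit Types (f : 'cV[R]_d -> R) (x v : 'cV[R]_d).

Lemma derive_grad f x v : differentiable (f : _ -> R^o) x ->
  'D_v (f : _ -> R^o) x = inner (grad f x) v.
Proof.
move=> df.
have vE : v = \sum_j v j 0 *: delta_mx j 0.
  rewrite [LHS]matrix_sum_delta; apply: eq_bigr => j _.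
  by rewrite big_ord1.
rewrite deriveE// [in LHS]vE linear_sum innerE /=.
apply: eq_bigr => j _; rewrite linearZ/= !mxE deriveE// mulrC//.
Qed.

Lemma is_derive_line f x v t : differentiable (f : _ -> R^o) (x + t *: v) ->
  is_derive t 1 (fun s => f (x + s *: v) : R^o) (inner (grad f (x + t *: v)) v).
Proof.
move=> df; rewrite -derive_grad//.
have E : (fun h : R => h^-1 *: (((fun s => f (x + s *: v) : R^o) \o shift t) (h *: 1)
    - f (x + t *: v) : R^o)) =
  (fun h : R => h^-1 *: (((f : _ -> R^o) \o shift (x + t *: v)) (h *: v)
    - f (x + t *: v) : R^o)).
  apply/funext => h /=; congr (_ *: (f _ - _)).
  by rewrite [h *: 1]mulr1 scalerDl addrCA.
split; last by rewrite /derive E.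
by rewrite /derivable E; exact: diff_derivable.
Qed.

(** The mean value theorem, applied along the segment from x to y to the
    difference between f and its quadratic upper model; at an intermediate
    point x + c v, Cauchy-Schwarz and the Lipschitz bound show that the
    derivative of this difference is nonpositive. *)
Lemma descent f (U : set 'cV[R]_d) (L : R) x y :
  (forall t : R, 0 <= t <= 1 -> U (x + t *: (y - x))) ->
  (forall z, U z -> differentiable (f : _ -> R^o) z) ->
  elipschitz_on L U (grad f) ->
  f y <= f x + inner (grad f x) (y - x) + 2^-1 * L * inner (y - x) (y - x).
Proof.
move=> Uxy df lipf; set v := y - x.
pose l t : R^o := f (x + t *: v).
pose g : R^o -> R^o := l - (inner (grad f x) v) \*: (id : R^o -> R^o)
  - (2^-1 * L * inner v v) \*: ((id : R^o -> R^o) ^+ 2).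
have dg (t : R) : 0 <= t <= 1 -> is_derive (t : R^o) (1 : R^o) g
    (inner (grad f (x + t *: v)) v - inner (grad f x) v - t * L * inner v v).
  move=> t01; have dl : is_derive (t : R^o) (1 : R^o) l (inner (grad f (x + t *: v)) v).
    exact: is_derive_line (df _ (Uxy _ t01)).
  apply: is_derive_eq; rewrite /GRing.scale/=.
  by rewrite expr1; field.
have gc : {within `[0, 1], continuous g}.
  apply: derivable_within_continuous => t; rewrite in_itv/= => t01.
  exact: (@ex_derive _ _ _ _ _ _ _ (dg t t01)).
have dgo (t : R) : t \in `]0, 1[ -> is_derive (t : R^o) (1 : R^o) g
    (inner (grad f (x + t *: v)) v - inner (grad f x) v - t * L * inner v v).
  rewrite in_itv/= => /andP[t0 t1]; apply: dg; by rewrite !ltW.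
have [c] := MVT_segment ler01 dgo gc.
rewrite in_itv/= => /andP[c0 c1].
rewrite subr0 mulr1.
have gE (t : R) :
    g t = f (x + t *: v) - inner (grad f x) v * t - 2^-1 * L * inner v v * (t * t).
  by [].
rewrite !gE scale1r scale0r addr0 (_ : x + v = y); last exact: subrKC.
suff : inner (grad f (x + c *: v)) v - inner (grad f x) v <= c * L * inner v v by lra.
rewrite -innerNl -innerDl (le_trans (inner_le_enorm _ _))//.
have Ux : U x by have := Uxy 0; rewrite scale0r addr0; apply; rewrite lexx ler01.
have Uc : U (x + c *: v) by apply: Uxy; rewrite c0.
have := lipf _ _ Uc Ux; rewrite [x + _]addrC addrK enormZ (ger0_norm c0) => h.
rewrite -sqr_enorm expr2 mulrA ler_wpM2r ?enorm_ge0//.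
by rewrite (le_trans h)// mulrCA mulrA.
Qed.

Lemma convex_functionE f x y (t : R) : convex_function setT f -> 0 <= t <= 1 ->
  f (t *: x + (1 - t) *: y) <= t * f x + (1 - t) * f y.
Proof.
move=> cf /andP[t0 t1].
by have := cf (Itv01 t0 t1) x y (in_setT _) (in_setT _).
Qed.

(** A difference quotient of a convex f along y - x, with step h in (0, 1], is
    at most f y - f x; let h tend to 0 from the right. *)
Lemma convex_grad f x y : convex_function setT f ->
  differentiable (f : _ -> R^o) x -> f x + inner (grad f x) (y - x) <= f y.
Proof.
move=> cf df; have := @diff_derivable _ _ _ (f : _ -> R^o) x (y - x) df.
rewrite -lerBrDl -derive_grad//.
rewrite /derive /derivable => cvf; have cvr := cvg_dnbhs_at_right cvf.
rewrite cvg_at_rightE//; apply: limr_le; first by apply: cvgP cvr.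
near=> h.
have h0 : 0 < h by [].
have h1 : h <= 1 by near: h; apply: nbhs_right_le.
rewrite /= /GRing.scale /= mulrC ler_pdivrMr//.
have -> : h *: (y - x) + x = h *: y + (1 - h) *: x.
  by rewrite scalerBr scalerBl scale1r addrAC -addrA addrC.
have := convex_functionE y x cf (_ : 0 <= h <= 1); rewrite (ltW h0) h1 => /(_ isT).
by lra.
Unshelve. all: by end_near.
Qed.

End Smooth.

(** * Extended-valued convex functions *)

Section Convex.
Context {R : realType} {d : nat}.
Implicit Types (F G : 'cV[R]_d -> \bar R).

Lemma econvexD F G : (forall x, -oo < F x)%E -> (forall x, -oo < G x)%E ->
  econvex F -> econvex G -> econvex (fun x => F x + G x)%E.
Proof.
move=> Fny Gny cF cG x y t t01.
have adF z : (F z +? G z)%E by rewrite ltninfty_adde_def// inE.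
rewrite !muleDr// addeACA; apply: leeD; [exact: cF|exact: cG].
Qed.

Lemma econvex_sum (I : finType) (F : I -> 'cV[R]_d -> \bar R) :
  (forall i x, -oo < F i x)%E -> (forall i, econvex (F i)) ->
  econvex (fun x => \sum_i F i x)%E.
Proof.
move=> Fny cF x y t t01.
have adF z i j : (F i z +? F j z)%E by rewrite ltninfty_adde_def// inE.
rewrite !fin_num_sume_distrr// -big_split/=.
by apply: lee_sum => i _; exact: cF.
Qed.

Lemma econvex_comp d' (F : 'cV[R]_d -> \bar R) (g : 'cV[R]_d' -> 'cV[R]_d) :
  (forall (x x' : 'cV[R]_d') (t : R),
     g (t *: x + (1 - t) *: x') = t *: g x + (1 - t) *: g x') ->
  econvex F -> econvex (F \o g).
Proof. by move=> gE cF x y t t01; rewrite /= gE; exact: cF. Qed.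

Lemma edom_convex F u v (t : R) :
  (forall z, -oo < F z)%E -> econvex F -> edom F u -> edom F v -> 0 <= t <= 1 ->
  edom F (t *: u + (1 - t) *: v).
Proof.
rewrite /edom /= => Fny cF Fu Fv t01; apply: (le_lt_trans (cF _ _ _ t01)).
have Fuf : F u \is a fin_num by rewrite fin_numElt Fny.
have Fvf : F v \is a fin_num by rewrite fin_numElt Fny.
by rewrite -(fineK Fuf) -(fineK Fvf) -!EFinM -EFinD ltry.
Qed.

(** Compare p with the points t z + (1 - t) p of the segment to z. Convexity
    of F and the identity for q bound the objective there by the chord minus t
    (1 - t) D; minimality of p then gives (1 - t) D <= (F + q) z - (F + q) p
    for all t in (0, 1), and t tends to 0. *)
Lemma argmin_three_point F (q : 'cV[R]_d -> R) (p z : 'cV[R]_d) (D : R) :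
  econvex F -> is_argmin (fun x => F x + (q x)%:E)%E p ->
  (forall t : R, q (t *: z + (1 - t) *: p) =
     t * q z + (1 - t) * q p - t * (1 - t) * D) ->
  F z \is a fin_num ->
  fine (F p) + q p + D <= fine (F z) + q z.
Proof.
move=> cF [Fqp_fin minp] qE Fz.
have Fp : F p \is a fin_num by move: Fqp_fin; rewrite fin_numD => /andP[].
set c := fine (F z) + q z - fine (F p) - q p.
have H (t : R) : 0 < t -> t < 1 -> (1 - t) * D <= c.
  move=> t0 t1; have := minp (t *: z + (1 - t) *: p).
  have := cF z p t; rewrite (ltW t0) (ltW t1) => /(_ isT) Ft Fq.
  have := le_trans Fq (leeD2r (q (t *: z + (1 - t) *: p))%:E Ft).
  rewrite -(fineK Fz) -(fineK Fp) -!EFinM -!EFinD lee_fin qE /c => h.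
  by rewrite -(ler_pM2l t0); lra.
suff : D <= c by rewrite /c; lra.
rewrite leNgt; apply/negP => cD.
have H2 := H 2^-1 ltac:(lra) ltac:(lra).
have D0 : 0 < D by lra.
have := H ((D - c) / (2 * D)).
rewrite divr_gt0 ?mulr_gt0 ?subr_gt0// ltr_pdivrMr ?mulr_gt0//.
have -> : (1 - (D - c) / (2 * D)) * D = (D + c) / 2 by field; rewrite gt_eqF.
by move=> /(_ isT) h; have := h ltac:(lra); lra.
Qed.

(** Jensen, by induction on the number of points: the mean of K + 2 points is
    the convex combination of the mean of the first K + 1 of them and of the
    last. *)
Lemma econvex_ergodic F (u : nat -> 'cV[R]_d) (K : nat) :
  econvex F -> (forall k, F (u k.+1) \is a fin_num) ->
  (F (ergodic u K.+1) <=
   (K.+1%:R^-1 * \sum_(1 <= k < K.+2) fine (F (u k)))%:E)%E.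
Proof.
move=> cF Fu; elim: K => [|K IH].
  by rewrite /ergodic !big_nat1 invr1 scale1r mul1r fineK.
pose a : R := K.+1%:R; pose b : R := K.+2%:R; pose t := a / b.
have a0 : a != 0 by rewrite pnatr_eq0.
have b0 : b != 0 by rewrite pnatr_eq0.
have tC : 1 - t = b^-1.
  by rewrite /t -[in 1](divff b0) -mulrBl /b -natr1 addrC addKr mul1r.
have taC : t * a^-1 = b^-1 by rewrite /t mulrAC divff ?mul1r.
have -> : ergodic u K.+2 = t *: ergodic u K.+1 + (1 - t) *: u K.+2.
  by rewrite /ergodic [in LHS]big_nat_recr//= scalerDr tC scalerA taC.
have t01 : 0 <= t <= 1.
  by rewrite /t divr_ge0//= ler_pdivrMr ?ltr0n// mul1r ler_nat.
apply: (le_trans (cF _ _ _ t01)).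
have [t0 _] := andP t01.
rewrite -(fineK (Fu _)).
apply: (le_trans (leeD2r _ (lee_wpmul2l _ IH))); first by rewrite lee_fin.
rewrite -!EFinM -EFinD lee_fin [in leRHS]big_nat_recr//= tC.
by rewrite mulrDr mulrA taC.
Qed.

End Convex.

(** * Block vectors *)

Section Blocks.
Context {R : realType} {N : nat}.

Lemma inner_mxdiag (p : 'I_N -> nat) (c : 'I_N -> R)
    (x y : 'cV[R]_(\sum_(i < N) p i)) :
  inner x (\mxdiag_(i < N) ((c i)%:M : 'M[R]_(p i)) *m y) =
  \sum_i c i * inner (submxcol x i) (submxcol y i).
Proof.
rewrite /inner -[in LHS](submxcolK x) -[in LHS](submxcolK y).
rewrite tr_mxcol mul_mxdiag_mxcol mul_mxrow_mxcol summxE.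
by apply: eq_bigr => i _; rewrite mul_scalar_mx -scalemxAr mxE.
Qed.

Lemma inner_blocks (p : 'I_N -> nat) (x y : 'cV[R]_(\sum_(i < N) p i)) :
  inner x y = \sum_i inner (submxcol x i) (submxcol y i).
Proof.
have := inner_mxdiag (fun=> 1) x y; rewrite mxdiagZ mul1mx => ->.
by apply: eq_bigr => i _; rewrite mul1r.
Qed.

Lemma sume_gtNy (I : finType) (F : I -> \bar R) :
  (forall i, -oo < F i)%E -> (-oo < \sum_i F i)%E.
Proof.
move=> Fny; rewrite ltNye; apply/negP => /eqP/esum_eqNyP[i [_ _ Fi]].
by have := Fny i; rewrite Fi ltxx.
Qed.

End Blocks.

Section SeparableFunctions.
Context {R : realType} {N n : nat} {m : 'I_N -> nat} {m0 : nat}.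
Implicit Types (x : 'cV[R]_(\sum_(i < N) n))
  (y : 'cV[R]_(\sum_(i < N) m i + m0)).

Lemma xblock_line x x' (t : R) i :
  xblock (t *: x + (1 - t) *: x') i = t *: xblock x i + (1 - t) *: xblock x' i.
Proof. by apply/matrixP => j k; rewrite !mxE. Qed.

Lemma xblockB x x' i : xblock (x - x') i = xblock x i - xblock x' i.
Proof. exact: submxcolB. Qed.

Lemma thetapart_line y y' (t : R) :
  thetapart (t *: y + (1 - t) *: y') = t *: thetapart y + (1 - t) *: thetapart y'.
Proof. by apply/matrixP => j k; rewrite !mxE. Qed.

Lemma lambdapart_line y y' (t : R) :
  lambdapart (t *: y + (1 - t) *: y') = t *: lambdapart y + (1 - t) *: lambdapart y'.
Proof. by apply/matrixP => j k; rewrite !mxE. Qed.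

Lemma thetablock_line y y' (t : R) i :
  thetablock (t *: y + (1 - t) *: y') i =
  t *: thetablock y i + (1 - t) *: thetablock y' i.
Proof. by apply/matrixP => j k; rewrite !mxE. Qed.

Lemma rho_sum_gtNy (rho : 'I_N -> 'cV[R]_n -> \bar R) x :
  (forall i, eproper (rho i)) -> (-oo < rho_sum rho x)%E.
Proof. by move=> pr; apply: sume_gtNy => i; apply: (pr i).1. Qed.

Lemma h_sum_gtNy (h0 : 'cV[R]_m0 -> \bar R) (h : forall i, 'cV[R]_(m i) -> \bar R) y :
  eproper h0 -> (forall i, eproper (h i)) -> (-oo < h_sum h0 h y)%E.
Proof.
move=> p0 ph; rewrite /h_sum.
have := p0.1 (lambdapart y).
have := sume_gtNy (F := fun i => h i (thetablock y i)) (fun i => (ph i).1 _).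
by rewrite !ltNye adde_eq_ninfty negb_or => -> ->.
Qed.

Lemma econvex_rho_sum (rho : 'I_N -> 'cV[R]_n -> \bar R) :
  (forall i, eproper (rho i)) -> (forall i, econvex (rho i)) ->
  econvex (rho_sum rho).
Proof.
move=> pr cr; apply: econvex_sum => [i x|i]; first exact: (pr i).1.
apply: (econvex_comp _ (cr i)) => x x' t; exact: xblock_line.
Qed.

Lemma econvex_h_sum (h0 : 'cV[R]_m0 -> \bar R) (h : forall i, 'cV[R]_(m i) -> \bar R) :
  eproper h0 -> (forall i, eproper (h i)) ->
  econvex h0 -> (forall i, econvex (h i)) -> econvex (h_sum h0 h).
Proof.
move=> p0 ph c0 ch; apply: econvexD.
- by move=> y; exact: p0.1.
- by move=> y; apply: sume_gtNy => i; exact: (ph i).1.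
- apply: (econvex_comp _ c0) => y y' t; exact: lambdapart_line.
- apply: econvex_sum => [i y|i]; first exact: (ph i).1.
  apply: (econvex_comp _ (ch i)) => y y' t; exact: thetablock_line.
Qed.

Lemma rho_sum_fin (rho : 'I_N -> 'cV[R]_n -> \bar R) x i :
  rho_sum rho x \is a fin_num -> edom (rho i) (xblock x i).
Proof.
by move=> /sum_fin_numP/(_ i (mem_index_enum _) isT); rewrite fin_numElt => /andP[].
Qed.

Lemma PhiE (rho : 'I_N -> 'cV[R]_n -> \bar R) (f : 'I_N -> 'cV[R]_n -> R) x :
  Phi rho f x = (rho_sum rho x + (f_sum f x)%:E)%E.
Proof. by rewrite /Phi big_split /= sumEFin. Qed.

Lemma econvex_Phi (rho : 'I_N -> 'cV[R]_n -> \bar R) (f : 'I_N -> 'cV[R]_n -> R) :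
  (forall i, eproper (rho i)) -> (forall i, econvex (rho i)) ->
  (forall i, convex_function setT (f i)) -> econvex (Phi rho f).
Proof.
move=> pr cr cf; have -> : Phi rho f = fun x => (rho_sum rho x + (f_sum f x)%:E)%E.
  by apply/funext => x; exact: PhiE.
apply: econvexD => [x|x||x x' t t01].
- exact: rho_sum_gtNy.
- exact: ltNyr.
- exact: econvex_rho_sum.
rewrite -!EFinM -EFinD lee_fin /f_sum !mulr_sumr -big_split/=.
apply: ler_sum => i _; rewrite xblock_line; exact: convex_functionE.
Qed.

(** Moving along a coordinate of block i changes only the i-th summand, so the
    difference quotients of the sum and of f_i are the same functions of the
    step. *)
Lemma xblock_grad (f : 'I_N -> 'cV[R]_n -> R) x i :
  xblock (grad (f_sum f) x) i = grad (f i) (xblock x i).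
Proof.
apply/matrixP => j k; rewrite !mxE /derive.
set F := (F in lim (F @ _)); set G := (G in _ = lim (G @ _)).
suff -> : F = G by [].
apply/funext => h; rewrite /F /G /=; congr (_ *: _).
rewrite /f_sum -sumrB (bigD1 i)//= [X in _ + X]big1 ?addr0 => [|l li].
  congr (f i _ - _); apply/matrixP => a b; rewrite !mxE.
  by rewrite -val_eqE /= tagnat.eq_Rank eqxx.
have -> : xblock (h *: delta_mx (tagnat.Rank i j) 0 + x) l = xblock x l.
  apply/matrixP => a b; rewrite !mxE.
  by rewrite -val_eqE /= tagnat.eq_Rank (negbTE li) mulr0 add0r.
exact: subrr.
Qed.

(** Block by block, the descent lemma from xk to xk1 minus the gradient
    inequality from xk to x. *)
Lemma f_sum_step (f : 'I_N -> 'cV[R]_n -> R) (U : 'I_N -> set 'cV[R]_n)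
    (L : 'I_N -> R) xk xk1 x :
  (forall i, convex_function setT (f i)) ->
  (forall i z, U i z -> differentiable (f i : 'cV[R]_n -> R^o) z) ->
  (forall i, elipschitz_on (L i) (U i) (grad (f i))) ->
  (forall i (t : R), 0 <= t <= 1 -> U i (t *: xblock xk1 i + (1 - t) *: xblock xk i)) ->
  f_sum f xk1 - f_sum f x <= inner (grad (f_sum f) xk) (xk1 - x)
    + 2^-1 * \sum_i L i * inner (xblock (xk1 - xk) i) (xblock (xk1 - xk) i).
Proof.
move=> cf df lf seg; rewrite (inner_blocks (p := fun=> n)) /f_sum.
rewrite -sumrB mulr_sumr -big_split/=.
apply: ler_sum => i _.
rewrite -!/(xblock _ _) xblock_grad !xblockB.
set u := xblock xk i; set u1 := xblock xk1 i; set v := xblock x i.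
have Uu : U i u by have := seg i 0; rewrite scale0r add0r subr0 scale1r lexx ler01; apply.
have := convex_grad v (cf i) (df i _ Uu).
have := @descent R n (f i) (U i) (L i) u u1 _ (df i) (lf i).
have Useg t : 0 <= t <= 1 -> U i (u + t *: (u1 - u)).
  move=> t01; have -> : u + t *: (u1 - u) = t *: u1 + (1 - t) *: u.
    by apply/matrixP => a b; rewrite !mxE; ring.
  exact: seg.
move=> /(_ Useg); rewrite !inner_lin; lra.
Qed.

End SeparableFunctions.

(** * One iteration *)

Section Iteration.
Context {R : realType} {N n : nat} {m : 'I_N -> nat} {m0 : nat}.
Implicit Types (x : 'cV[R]_(\sum_(i < N) n))
  (y : 'cV[R]_(\sum_(i < N) m i + m0)).
Context (A : forall i : 'I_N, 'M[R]_(m i, n)) (A0 : 'M[R]_(m0, \sum_(i < N) n)).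
Context (tau L kappa : 'I_N -> R) (gamma : R).
Context (tau_gt0 : forall i, 0 < tau i) (kappa_gt0 : forall i, 0 < kappa i).
Context (gamma_gt0 : 0 < gamma).
Let T := mxT A A0.

Lemma bregmanXE x x' :
  bregmanX tau x x' = 2^-1 * inner (x - x') (Dtau n tau *m (x - x')).
Proof.
rewrite /bregmanX qnormE// inner_mxdiag sumr_ge0// => i _.
by rewrite mulr_ge0 ?inner_ge0// invr_ge0 ltW.
Qed.

Lemma bregmanYE y y' :
  bregmanY kappa gamma y y' =
  2^-1 * inner (thetapart y - thetapart y')
           (Dkappa m kappa *m (thetapart y - thetapart y'))
  + 2^-1 * inner (lambdapart y - lambdapart y')
           (Dgamma m0 gamma *m (lambdapart y - lambdapart y')).
Proof.
rewrite /bregmanY !qnormE//.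
  by rewrite mul_scalar_mx innerZr mulr_ge0 ?inner_ge0// invr_ge0 ltW.
rewrite inner_mxdiag sumr_ge0// => i _.
by rewrite mulr_ge0 ?inner_ge0// invr_ge0 ltW.
Qed.

Lemma bregmanX_conv x z p (t : R) :
  bregmanX tau (t *: z + (1 - t) *: p) x =
  t * bregmanX tau z x + (1 - t) * bregmanX tau p x
  - t * (1 - t) * bregmanX tau z p.
Proof.
rewrite !bregmanXE lineB quad_conv /=.
by rewrite opprB addrA subrK; ring.
Qed.

Lemma bregmanY_conv y z p (t : R) :
  bregmanY kappa gamma (t *: z + (1 - t) *: p) y =
  t * bregmanY kappa gamma z y + (1 - t) * bregmanY kappa gamma p y
  - t * (1 - t) * bregmanY kappa gamma z p.
Proof.
rewrite !bregmanYE thetapart_line lambdapart_line.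
rewrite !lineB !quad_conv /= !opprB !addrA !subrK; ring.
Qed.

Lemma xstep_ineq (rho : 'I_N -> 'cV[R]_n -> \bar R) (f : 'I_N -> 'cV[R]_n -> R)
    xk yk xk1 x :
  econvex (rho_sum rho) -> is_argmin (xobjective rho f A A0 tau xk yk) xk1 ->
  rho_sum rho x \is a fin_num ->
  fine (rho_sum rho xk1) + inner (grad (f_sum f) xk) (xk1 - x)
    + inner (T *m (xk1 - x)) yk + bregmanX tau xk1 xk + bregmanX tau x xk1
  <= fine (rho_sum rho x) + bregmanX tau x xk.
Proof.
move=> cr amin rx.
pose q z := f_sum f xk + inner (grad (f_sum f) xk) (z - xk)
  + inner (mxT A A0 *m z) yk + bregmanX tau z xk.
have qE (t : R) : q (t *: x + (1 - t) *: xk1) =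
    t * q x + (1 - t) * q xk1 - t * (1 - t) * bregmanX tau x xk1.
  by rewrite /q bregmanX_conv mulmxDr -!scalemxAr !inner_lin; ring.
have := argmin_three_point cr (amin : is_argmin (fun z => _ + (q z)%:E)%E _) qE rx.
rewrite /q mulmxDr mulmxN !inner_lin -/T; lra.
Qed.

Lemma ystep_ineq (h0 : 'cV[R]_m0 -> \bar R) (h : forall i, 'cV[R]_(m i) -> \bar R)
    xk xk1 yk yk1 y :
  econvex (h_sum h0 h) ->
  is_argmin (yobjective h0 h A A0 kappa gamma xk xk1 yk) yk1 ->
  h_sum h0 h y \is a fin_num ->
  fine (h_sum h0 h yk1) - inner (T *m (2 *: xk1 - xk)) (yk1 - y)
    + bregmanY kappa gamma yk1 yk + bregmanY kappa gamma y yk1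
  <= fine (h_sum h0 h y) + bregmanY kappa gamma y yk.
Proof.
move=> ch amin hy.
set w := T *m _.
pose q z := - inner w z + bregmanY kappa gamma z yk.
have qE (t : R) : q (t *: y + (1 - t) *: yk1) =
    t * q y + (1 - t) * q yk1 - t * (1 - t) * bregmanY kappa gamma y yk1.
  by rewrite /q bregmanY_conv !inner_lin; ring.
have := argmin_three_point ch (amin : is_argmin (fun z => _ + (q z)%:E)%E _) qE hy.
rewrite /q !inner_lin; lra.
Qed.

Lemma Qbar_form x y :
  let z := col_mx x y in
  inner z (Qbar A A0 tau L kappa gamma *m z) =
  inner x (Dtau n tau *m x) - \sum_i L i * inner (xblock x i) (xblock x i)
  - 2 * inner (mxT A A0 *m x) y
  + inner (thetapart y) (Dkappa m kappa *m thetapart y)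
  + inner (lambdapart y) (Dgamma m0 gamma *m lambdapart y).
Proof.
rewrite /= -(vsubmxK y) -/(thetapart y) -/(lambdapart y).
set th := thetapart y; set la := lambdapart y.
rewrite /thetapart /lambdapart col_mxKu col_mxKd.
have inner_col d1 d2 (a1 b1 : 'cV[R]_d1) (a2 b2 : 'cV[R]_d2) :
    inner (col_mx a1 a2) (col_mx b1 b2) = inner a1 b1 + inner a2 b2.
  by rewrite /inner tr_col_mx mul_row_col mxE.
rewrite /Qbar /mxT !mul_block_col !mul_col_mx !mul_row_col !mul0mx addr0 add0r.
rewrite !(add_col_mx, inner_col, mulNmx, inner_lin).
rewrite -!inner_mulmx.
rewrite (innerC th) (innerC la).
have -> : Dtaubar n tau L = Dtau n tau - \mxdiag_(i < N) ((L i)%:M : 'M[R]_n).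
  rewrite /Dtaubar /Dtau -mxdiagB; apply: eq_mxdiag => i.
  exact: raddfB.
rewrite mulmxBl inner_lin innerNr (inner_mxdiag L) /xblock.
ring.
Qed.

(** The potential V_k, with (x', y') for the k-th iterate: half the squared
    distance from (x, y) to (x', y') in the form of Qbar without its L_i. *)
Definition merit x y x' y' :=
  bregmanX tau x x' + bregmanY kappa gamma y y' - inner (T *m (x - x')) (y - y').

(** Half the form of Qbar, which has 1/tau_i - L_i where D_x has 1/tau_i; the
    difference is the left-hand side. *)
Lemma merit_ge x y x' y' : psdmx (Qbar A A0 tau L kappa gamma) ->
  2^-1 * (\sum_i L i * inner (xblock (x - x') i) (xblock (x - x') i))
  <= merit x y x' y'.
Proof.
move=> [_ /(_ (col_mx (x - x') (y - y')))]; rewrite -mulmxA.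
rewrite -/(inner _ _) Qbar_form /merit bregmanXE bregmanYE.
rewrite /thetapart /lambdapart !linearB /= -/T; lra.
Qed.

(** The quadratic terms only occur as they stand, so this is an identity
    between bilinear terms; it is where the extrapolation 2 xk1 - xk is
    needed. *)
Lemma merit_three_point xk yk xk1 yk1 x y :
  inner (T *m xk1) y - inner (T *m x) yk1 - inner (T *m (xk1 - x)) yk
  + inner (T *m (2 *: xk1 - xk)) (yk1 - y)
  + bregmanX tau x xk - bregmanX tau x xk1 - bregmanX tau xk1 xk
  + bregmanY kappa gamma y yk - bregmanY kappa gamma y yk1
  - bregmanY kappa gamma yk1 yk
  = merit x y xk yk - merit x y xk1 yk1 - merit xk1 yk1 xk yk.
Proof.
rewrite /merit !(mulmxDr, mulmxN, inner_lin) -!scalemxAr !inner_lin; ring.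
Qed.

End Iteration.

(** * The ergodic rate *)

Unset Implicit Arguments.

Theorem theorem1p1 (R : realType) (N n : nat) (m : 'I_N -> nat) (m0 : nat)
  (* the functions rho_i and f_i *)
  (rho : 'I_N -> 'cV[R]_n -> \bar R) (f : 'I_N -> 'cV[R]_n -> R)
  (U : 'I_N -> set 'cV[R]_n) (L : 'I_N -> R)
  (rho_proper : forall i, eproper (rho i))
  (rho_convex : forall i, econvex (rho i))
  (rho_prox : forall i, has_prox (rho i))
  (f_convex : forall i, convex_function setT (f i))
  (U_open : forall i, open (U i))
  (U_dom : forall i, edom (rho i) `<=` U i)
  (f_diff : forall i x, U i x -> differentiable (f i : 'cV[R]_n -> R^o) x)
  (f_lip : forall i, elipschitz_on (L i) (U i) (grad (f i)))
  (* the functions h_0 and h_i *)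
  (h0 : 'cV[R]_m0 -> \bar R) (h : forall i : 'I_N, 'cV[R]_(m i) -> \bar R)
  (h0_proper : eproper h0) (h_proper : forall i, eproper (h i))
  (h0_convex : econvex h0) (h_convex : forall i, econvex (h i))
  (h0_closed : lower_semicontinuous h0)
  (h_closed : forall i, lower_semicontinuous (h i))
  (h0_prox : has_prox h0) (h_prox : forall i, has_prox (h i))
  (* the matrices and the step sizes *)
  (A : forall i : 'I_N, 'M[R]_(m i, n)) (A0 : 'M[R]_(m0, \sum_(i < N) n))
  (gamma : R) (tau kappa : 'I_N -> R)
  (gamma_gt0 : 0 < gamma)
  (tau_gt0 : forall i, 0 < tau i) (kappa_gt0 : forall i, 0 < kappa i)
  (* the iterates *)
  (xs : nat -> 'cV[R]_(\sum_(i < N) n))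
  (ys : nat -> 'cV[R]_(\sum_(i < N) m i + m0))
  (* the f_i are smooth between the initial point and the domain of rho_i *)
  (x0_smooth : forall i z (t : R), edom (rho i) z -> 0 <= t <= 1 ->
     U i (t *: z + (1 - t) *: xblock (xs 0%N) i))
  (xstep : forall k,
     is_argmin (xobjective rho f A A0 tau (xs k) (ys k)) (xs k.+1))
  (ystep : forall k,
     is_argmin (yobjective h0 h A A0 kappa gamma (xs k) (xs k.+1) (ys k))
               (ys k.+1))
  (Qbar_psd : psdmx (Qbar A A0 tau L kappa gamma)) :
  forall (K : nat), (1 <= K)%N ->
  forall (x : 'cV[R]_(\sum_(i < N) n))
         (y : 'cV[R]_(\sum_(i < N) m i + m0)),
  (Lagrangian rho f h0 h A A0 (ergodic xs K) y
     - Lagrangian rho f h0 h A A0 x (ergodic ys K)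
   <= (K%:R^-1 * (bregmanX tau x (xs 0%N) + bregmanY kappa gamma y (ys 0%N)
         - inner (mxT A A0 *m (x - xs 0%N)) (y - ys 0%N)))%:E)%E.
Proof.
move=> K K1 x y.
set T := mxT A A0.
pose r := rho_sum rho; pose H := h_sum h0 h.
have r_gt x' : (-oo < r x')%E by exact: rho_sum_gtNy.
have H_gt y' : (-oo < H y')%E by exact: h_sum_gtNy.
have r_cvx : econvex r by exact: econvex_rho_sum.
have H_cvx : econvex H by exact: econvex_h_sum.
have Phi_cvx : econvex (Phi rho f) by exact: econvex_Phi.
have rk k : r (xs k.+1) \is a fin_num.
  by have [] := xstep k; rewrite /xobjective fin_numD => /andP[].
have Hk k : H (ys k.+1) \is a fin_num.
  by have [] := ystep k; rewrite /yobjective fin_numD => /andP[].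
have Phik k : Phi rho f (xs k.+1) \is a fin_num by rewrite PhiE fin_numD rk.
case: K K1 => // K _.
have Phi_bar := econvex_ergodic K Phi_cvx Phik.
have H_bar := econvex_ergodic K H_cvx Hk.
set xb := ergodic xs K.+1 in Phi_bar *; set yb := ergodic ys K.+1 in H_bar *.
have Phib : Phi rho f xb \is a fin_num.
  rewrite fin_numElt (le_lt_trans Phi_bar (ltry _)) andbT PhiE.
  by rewrite ltNye adde_eq_ninfty negb_or -!ltNye r_gt ltNyr.
have Hb : H yb \is a fin_num.
  by rewrite fin_numElt H_gt (le_lt_trans H_bar (ltry _)).
rewrite /Lagrangian -/H -/T.
(* Degenerate comparison points: the gap is -oo. *)
have [Hy|Hy] := boolP (H y \is a fin_num); last first.
  have -> : H y = +oo%E.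
    by move: Hy; rewrite fin_numElt H_gt/= -leNgt leye_eq => /eqP.
  by rewrite addeNy addNye leNye.
have [rx|rx] := boolP (r x \is a fin_num); last first.
  have -> : Phi rho f x = +oo%E.
    have -> : Phi rho f x = (r x + (f_sum f x)%:E)%E by exact: PhiE.
    have -> : r x = +oo%E; last by rewrite addye.
    by move: rx; rewrite fin_numElt r_gt/= -leNgt leye_eq => /eqP.
  rewrite -(fineK Hb) !addye//= addeNy leNye//.
have Phix : Phi rho f x \is a fin_num by rewrite PhiE fin_numD rx.
rewrite -(fineK Phib) -(fineK Phix) -(fineK Hy) -(fineK Hb).
rewrite -!EFinN -!EFinD lee_fin.
have PhiF x' : r x' \is a fin_num -> fine (Phi rho f x') = fine (r x') + f_sum f x'.
  by move=> rx'; rewrite PhiE fineD.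
pose V k := merit A A0 tau kappa gamma x y (xs k) (ys k).
pose gap k := fine (Phi rho f (xs k)) + inner (T *m xs k) y - fine (H y)
  - (fine (Phi rho f x) + inner (T *m x) (ys k) - fine (H (ys k))).
(* For k = 0 the starting point may lie outside the domain of rho, so the
   convexity of this domain only serves from k = 1 on. *)
have seg k i (t : R) : 0 <= t <= 1 ->
    U i (t *: xblock (xs k.+1) i + (1 - t) *: xblock (xs k) i).
  move=> t01; have d1 := rho_sum_fin i (rk k).
  case: k d1 => [|k] d1; first exact: x0_smooth.
  apply: U_dom; apply: edom_convex => //; first exact: (rho_proper i).1.
  exact: rho_sum_fin (rk k).
have gap_le k : gap k.+1 <= V k - V k.+1.
  have xi := xstep_ineq tau_gt0 r_cvx (xstep k) rx.
  have yi := ystep_ineq kappa_gt0 gamma_gt0 H_cvx (ystep k) Hy.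
  have fi := f_sum_step x f_convex f_diff f_lip (seg k).
  have mi := merit_ge tau_gt0 kappa_gt0 gamma_gt0
    (xs k.+1) (ys k.+1) (xs k) (ys k) Qbar_psd.
  have me := merit_three_point A A0 tau kappa gamma
    (xs k) (ys k) (xs k.+1) (ys k.+1) x y.
  rewrite /gap /V !PhiF//; rewrite -/r -/H -/T in xi yi fi mi me *.
  lra.
(* The Lipschitz bound between u and v forces 0 <= L i * enorm (u - v). *)
have V_ge0 : 0 <= V K.+1.
  have mi := merit_ge tau_gt0 kappa_gt0 gamma_gt0
    x y (xs K.+1) (ys K.+1) Qbar_psd.
  apply: le_trans mi; rewrite mulr_ge0// sumr_ge0// => i _.
  rewrite xblockB; set u := xblock x i; set v := xblock (xs K.+1) i.
  rewrite -sqr_enorm expr2 mulrA mulr_ge0 ?enorm_ge0//.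
  apply: le_trans (enorm_ge0 _) (f_lip i u v _ _); apply: U_dom;
    exact: rho_sum_fin.
have sum_gap : \sum_(1 <= k < K.+2) gap k <= V 0%N.
  rewrite big_add1 /=.
  apply: (@le_trans _ _ (\sum_(0 <= k < K.+1) (V k - V k.+1))).
    by apply: ler_sum => k _; exact: gap_le.
  under eq_bigr do rewrite -opprB.
  by rewrite sumrN telescope_sumr// opprB lerBlDr lerDl.
have innb : inner (T *m x) yb =
    K.+1%:R^-1 * \sum_(1 <= k < K.+2) inner (T *m x) (ys k).
  rewrite innerC -[yb]mul1mx inner_ergodic; congr (_ * _).
  by apply: eq_bigr => k _; rewrite mul1mx innerC.
move: Phi_bar H_bar;
rewrite -(fineK Phib) -(fineK Hb) !lee_fin => Phi_bar H_bar.
rewrite -/(merit _ _ _ _ _ _ _ _ _) -/(V 0%N).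
have K0 : (0 : R) < K.+1%:R^-1 by rewrite invr_gt0 ltr0n.
apply: (le_trans _ (ler_wpM2l (ltW K0) sum_gap)).
rewrite innb /xb inner_ergodic -/xb /gap.
have cst (c : R) : K.+1%:R^-1 * (c *+ (K.+2 - 1)) = c.
  by rewrite subn1 /= -[c *+ _]mulr_natl mulKf ?pnatr_eq0.
rewrite !(sumrB, big_split) /= !sumr_const_nat !(mulrBr, mulrDr) !cst.
by apply: lerB; [apply: lerB => //; apply: lerD | apply: lerB].
Qed.
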